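(* Let $b$ be a positive integer. For $0<t<1$ put $q=\frac{1-t}{1+t}$ and \[ f_b(t):=2\sum_{n=0}^\infty (-1)^n q^{n^2+bn}. \] Let $f_b(t)\sim\sum_{n=0}^\infty a_n t^n$ be the asymptotic expansion of $f_b$ as $t\to 0^+$ (see context). If $b\equiv 1,2\pmod 4$, then $a_n>0$ for all sufficiently large $n$; if $b\equiv 0,3\pmod 4$, then $a_n<0$ for all sufficiently large $n$. In particular, for every positive integer $b$ the coefficients $a_n$ all have the same sign for sufficiently large $n$.
   Context: The function $f_b(t)$ (a partial theta function) admits an asymptotic power series expansion $f_b(t)\sim\sum_{n\ge0}a_nt^n$ as $t\to0^+$ with real coefficients $a_n$ depending on $b$. This means that for every $N\ge 0$ one has $f_b(t)-\sum_{n=0}^{N}a_nt^n=O(t^{N+1})$ as $t\to 0^+$; the existence of such an expansion is a known result of Berndt and Kim, and the coefficients $a_n$ are uniquely determined by $f_b$. *)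

(* Defs.v *)
From Stdlib Require Import Reals Lra Lia.
From Coquelicot Require Import Coquelicot.
Open Scope R_scope.

Definition qpar (t : R) : R := (1 - t) / (1 + t).

Definition fb (b : nat) (t : R) : R :=
  2 * Series (fun n : nat => (-1) ^ n * qpar t ^ (n * n + b * n)%nat).

Definition asymp_expansion (f : R -> R) (a : nat -> R) : Prop :=
  forall N : nat, exists C delta : R, 0 < delta /\
    forall t : R, 0 < t < delta -> t < 1 ->
      Rabs (f t - sum_f_R0 (fun n => a n * t ^ n) N) <= C * t ^ (N + 1).

(* Main.v *)
Require Import Defs.
From Stdlib Require Import Reals Lra Lia Arith.
From Coquelicot Require Import Coquelicot.
Open Scope R_scope.

(* Write f_b for [fb b].  Since (n+1)^2 + b(n+1) = n^2 + (b+2)n + (b+1), one has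
   q^(b+1) f_(b+2) = 2 - f_b, so the expansion of f_(b+2) is that of 2 - f_b times
   ((1+t)/(1-t))^(b+1).  Multiplication by 1/(1-t) takes partial sums, hence coefficients that
   eventually have one sign and are bounded away from 0 stay so, while 2 - f_b flips the sign.
   It remains to treat b = 0 (where f_0 ~ 1) and b = 1 (where all coefficients are positive).

   Euler's transformation of the alternating series, whose remainder is controlled by the
   derivatives of a Gaussian, gives a_n = L(i |-> [t^n] q^(i^2 + b i)), where L is the linear
   functional "Abel sum of 2 (-1)^i h(i)" on polynomials h.  By L(h(i) + h(i+1)) = 2 h(0), L
   annihilates the Meixner-Pollaczek type polynomials [u^k] (1+u)^i / (1-u)^(i+b) for k >= 2 if
   b = 0 and for k >= 1 if b = 1.  Multiplication by -i(i+b) preserves the span of those of even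
   index k; for b = 1 it has nonnegative coefficients in the basis with alternating signs, and
   the coefficients of [t^n] q^x as a polynomial in -x are nonnegative too. *)

(** * Asymptotic expansions *)

(** The clause of order [N] of [asymp_expansion], isolated so that closure properties can be proved
    one order at a time; [asymp_expansion f a] unfolds to [forall N, approx N f a]. *)
Definition approx (N : nat) (f : R -> R) (a : nat -> R) : Prop :=
  exists C delta : R, 0 < delta /\
    forall t : R, 0 < t < delta -> t < 1 ->
      Rabs (f t - sum_f_R0 (fun n => a n * t ^ n) N) <= C * t ^ (N + 1).

Lemma approx_ext (N : nat) (f g : R -> R) (a b : nat -> R) :
  (forall t, 0 < t < 1 -> f t = g t) -> (forall n, (n <= N)%nat -> a n = b n) ->
  approx N f a -> approx N g b.
Proof.
  intros Hf Ha (C & d & Hd & H).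
  exists C, d; split; [exact Hd|].
  intros t Ht Ht1.
  rewrite <- Hf by lra.
  rewrite <- (sum_eq (fun n => a n * t ^ n)) by (intros i Hi; now rewrite Ha).
  now apply H.
Qed.

Lemma approx_lin (N : nat) (f g : R -> R) (a b : nat -> R) (x y : R) :
  approx N f a -> approx N g b ->
  approx N (fun t => x * f t + y * g t) (fun n => x * a n + y * b n).
Proof.
  intros (C1 & d1 & Hd1 & H1) (C2 & d2 & Hd2 & H2).
  exists (Rabs x * C1 + Rabs y * C2), (Rmin d1 d2).
  split; [now apply Rmin_glb_lt|].
  intros t Ht Ht1.
  specialize (H1 t (conj (proj1 Ht) (Rlt_le_trans _ _ _ (proj2 Ht) (Rmin_l _ _))) Ht1).
  specialize (H2 t (conj (proj1 Ht) (Rlt_le_trans _ _ _ (proj2 Ht) (Rmin_r _ _))) Ht1).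
  set (A := sum_f_R0 (fun n => a n * t ^ n) N) in *.
  set (B := sum_f_R0 (fun n => b n * t ^ n) N) in *.
  replace (sum_f_R0 (fun n => (x * a n + y * b n) * t ^ n) N) with (x * A + y * B).
  - replace (x * f t + y * g t - (x * A + y * B))
      with (x * (f t - A) + y * (g t - B)) by ring.
    eapply Rle_trans; [apply Rabs_triang|].
    rewrite !Rabs_mult.
    pose proof (Rmult_le_compat_l _ _ _ (Rabs_pos x) H1).
    pose proof (Rmult_le_compat_l _ _ _ (Rabs_pos y) H2).
    lra.
  - unfold A, B. rewrite !scal_sum, <- plus_sum.
    apply sum_eq; intros; ring.
Qed.

Lemma approx_const (N : nat) (x : R) :
  approx N (fun _ => x) (fun n => match n with O => x | S _ => 0 end).
Proof.
  exists 0, 1; split; [lra|]; intros t Ht _.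
  replace (sum_f_R0 _ N) with x.
  - rewrite Rminus_diag, Rabs_R0. lra.
  - induction N as [|N IH]; simpl; [ring|]. rewrite <- IH. ring.
Qed.

(* The coefficients of [(1 + c t) * sum a_n t^n]. *)
Definition shift (c : R) (a : nat -> R) (n : nat) : R :=
  match n with O => a O | S m => a (S m) + c * a m end.

Lemma sum_shift (c : R) (a : nat -> R) (t : R) (N : nat) :
  sum_f_R0 (fun n => shift c a n * t ^ n) N =
  (1 + c * t) * sum_f_R0 (fun n => a n * t ^ n) N - c * a N * t ^ (N + 1).
Proof.
  induction N as [|N IH]; [simpl; ring|].
  rewrite !tech5, IH. replace (S N + 1)%nat with (S (S N)) by lia.
  replace (N + 1)%nat with (S N) by lia. simpl. ring.
Qed.

Lemma approx_mul (N : nat) (c : R) (f : R -> R) (a : nat -> R) :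
  approx N f a -> approx N (fun t => (1 + c * t) * f t) (shift c a).
Proof.
  intros (C & d & Hd & H).
  exists ((1 + Rabs c) * C + Rabs (c * a N)), d; split; [exact Hd|].
  intros t Ht Ht1. specialize (H t Ht Ht1).
  rewrite sum_shift.
  set (A := sum_f_R0 _ N) in *.
  replace ((1 + c * t) * f t - ((1 + c * t) * A - c * a N * t ^ (N + 1)))
    with ((1 + c * t) * (f t - A) + c * a N * t ^ (N + 1)) by ring.
  eapply Rle_trans; [apply Rabs_triang|].
  rewrite Rabs_mult, (Rabs_mult (c * a N)), (Rabs_pos_eq (t ^ _)) by (apply pow_le; lra).
  assert (Hc : Rabs (1 + c * t) <= 1 + Rabs c).
  { eapply Rle_trans; [apply Rabs_triang|].
    rewrite Rabs_R1, Rabs_mult, (Rabs_pos_eq t) by lra.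
    pose proof (Rabs_pos c). nra. }
  pose proof (Rmult_le_compat _ _ _ _ (Rabs_pos _) (Rabs_pos _) Hc H).
  lra.
Qed.

(** For [t < 1/2] the factor [1 + c t] is at least [1/2], so dividing by it at most doubles the
    error. The boundary term [c a_N t^(N+1)] of [sum_shift] is absorbed into the error. Quotients
    are thus handled without a reciprocal series. *)
Lemma approx_div (N : nat) (c : R) (f : R -> R) (a : nat -> R) :
  Rabs c <= 1 ->
  approx N (fun t => (1 + c * t) * f t) (shift c a) -> approx N f a.
Proof.
  intros Hc (C & d & Hd & H).
  exists (2 * (C + Rabs (c * a N))), (Rmin d (1 / 2)).
  split; [apply Rmin_glb_lt; lra|].
  intros t Ht Ht1.
  assert (Htd : 0 < t < d) by (pose proof (Rmin_l d (1 / 2)); lra).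
  assert (Ht2 : t < 1 / 2) by (pose proof (Rmin_r d (1 / 2)); lra).
  specialize (H t Htd Ht1). rewrite sum_shift in H.
  set (A := sum_f_R0 (fun n => a n * t ^ n) N) in *.
  assert (Hp : 0 <= t ^ (N + 1)) by (apply pow_le; lra).
  assert (H1 : Rabs ((1 + c * t) * (f t - A)) <= (C + Rabs (c * a N)) * t ^ (N + 1)).
  { replace ((1 + c * t) * (f t - A)) with
      (((1 + c * t) * f t - ((1 + c * t) * A - c * a N * t ^ (N + 1)))
       + - (c * a N * t ^ (N + 1))) by ring.
    eapply Rle_trans; [apply Rabs_triang|].
    rewrite Rabs_Ropp, (Rabs_mult (c * a N)), (Rabs_pos_eq (t ^ _)) by exact Hp.
    lra. }
  assert (H2 : 1 / 2 <= 1 + c * t).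
  { apply Rabs_le_between in Hc. nra. }
  rewrite Rabs_mult, (Rabs_pos_eq (1 + c * t)) in H1 by lra.
  pose proof (Rabs_pos (f t - A)). nra.
Qed.

(** If all earlier coefficients agree, the difference [e] of the [n]-th ones satisfies
    [e t^n = O(t^(n+1))], so [|e| <= C t] for all small [t]. *)
Lemma asymp_expansion_unique (f : R -> R) (a b : nat -> R) :
  asymp_expansion f a -> asymp_expansion f b -> forall n, a n = b n.
Proof.
  intros Ha Hb n. induction n as [n IH] using lt_wf_ind.
  destruct (approx_lin n f f a b 1 (-1) (Ha n) (Hb n)) as (C & d & Hd & H).
  set (e := a n - b n).
  assert (He : forall t, 0 < t < d -> t < 1 -> Rabs e <= C * t).
  { intros t Ht Ht1. specialize (H t Ht Ht1).
    replace (sum_f_R0 _ n) with (e * t ^ n) in H.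
    - replace (1 * f t + -1 * f t - e * t ^ n) with (- (e * t ^ n)) in H by ring.
      assert (0 < t ^ n) by (apply pow_lt; lra).
      rewrite Rabs_Ropp, Rabs_mult, (Rabs_pos_eq (t ^ n)), pow_add, pow_1 in H by lra.
      apply (Rmult_le_reg_r (t ^ n)); lra.
    - destruct n as [|n]; [unfold e; simpl; ring|].
      rewrite tech5. replace (sum_f_R0 _ n) with 0; [unfold e; ring|].
      symmetry. erewrite sum_eq; [apply sum_eq_R0 with (An := fun _ => 0); reflexivity|].
      intros i Hi. simpl. rewrite (IH i) by lia. ring. }
  destruct (Req_dec e 0) as [He0|He0]; [unfold e in He0; lra|].
  exfalso. assert (Hpos := Rabs_pos_lt e He0).
  assert (HC : 0 <= Rabs C) by apply Rabs_pos.
  (* At this point [2 (|C| + 1) t <= |e|], which contradicts [|e| <= C t]. *)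
  set (t := Rmin (Rmin (d / 2) (1 / 2)) (Rabs e / (2 * (Rabs C + 1)))).
  assert (Ht0 : 0 < t).
  { repeat apply Rmin_glb_lt; try lra. apply Rdiv_lt_0_compat; lra. }
  assert (Ht1 : t <= d / 2) by (eapply Rle_trans; [apply Rmin_l|apply Rmin_l]).
  assert (Ht2 : t <= 1 / 2) by (eapply Rle_trans; [apply Rmin_l|apply Rmin_r]).
  assert (Ht3 : t <= Rabs e / (2 * (Rabs C + 1))) by apply Rmin_r.
  specialize (He t ltac:(lra) ltac:(lra)).
  apply (Rmult_le_compat_r (2 * (Rabs C + 1))) in Ht3; [|lra].
  unfold Rdiv in Ht3. rewrite Rmult_assoc, Rinv_l, Rmult_1_r in Ht3 by lra.
  pose proof (Rle_abs C). nra.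
Qed.

(** * The coefficient functional *)

(* [meixner c X n] is the coefficient of [t^n] in [(1 + t)^X / (1 - t)^(X + c)]. *)
Fixpoint meixner (c X : R) (n : nat) : R :=
  match n with
  | O => 1
  | S m => match m with
           | O => 2 * X + c
           | S k => ((2 * X + c) * meixner c X m + (INR k + c) * meixner c X k) / INR n
           end
  end.

Lemma meixner_rec (c X : R) (k : nat) :
  INR (S (S k)) * meixner c X (S (S k)) =
  (2 * X + c) * meixner c X (S k) + (INR k + c) * meixner c X k.
Proof.
  change (meixner c X (S (S k))) with
    (((2 * X + c) * meixner c X (S k) + (INR k + c) * meixner c X k) / INR (S (S k))).
  field. apply not_0_INR. lia.
Qed.

(** Both sides are the coefficient of [t^n] in [(1 + t)^(X+1) / (1 - t)^(X+c)]. Two consecutive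
    indices are carried through the induction because the recurrence has order two. *)
Lemma meixner_contiguous (c X : R) (n : nat) :
  shift (-1) (meixner c (X + 1)) n = shift 1 (meixner c X) n.
Proof.
  enough (H : shift (-1) (meixner c (X + 1)) n = shift 1 (meixner c X) n /\
              shift (-1) (meixner c (X + 1)) (S n) = shift 1 (meixner c X) (S n)) by apply H.
  induction n as [|n [IH1 IH2]]; [simpl; split; ring|].
  split; [exact IH2|].
  assert (Hn : INR (S (S n)) <> 0) by (apply not_0_INR; lia).
  apply (Rmult_eq_reg_l (INR (S (S n)))); [|exact Hn].
  destruct n as [|n]; [unfold shift; simpl; field|].
  cbn [shift] in *.
  pose proof (meixner_rec c X (S n)) as A1. pose proof (meixner_rec c X n) as A2.
  pose proof (meixner_rec c (X + 1) (S n)) as B1. pose proof (meixner_rec c (X + 1) n) as B2.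
  rewrite !Rmult_plus_distr_l, A1, B1.
  (* These multipliers are the coefficients of the recurrence satisfied by that common generating
     function. *)
  apply (f_equal (Rmult (2 * X + 1 + c))) in IH2.
  apply (f_equal (Rmult (INR n + c))) in IH1.
  rewrite !S_INR in *. lra.
Qed.

Lemma meixner_0_0 (n : nat) : meixner 0 0 n = match n with O => 1 | S _ => 0 end.
Proof.
  induction n as [n IH] using lt_wf_ind.
  destruct n as [|[|n]]; [reflexivity|simpl; ring|].
  assert (Hn : INR (S (S n)) <> 0) by (apply not_0_INR; lia).
  apply (Rmult_eq_reg_l (INR (S (S n)))); [|exact Hn].
  rewrite meixner_rec, (IH (S n)), (IH n) by lia.
  destruct n; simpl; ring.
Qed.

Lemma meixner_1_0 (n : nat) : meixner 1 0 n = 1.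
Proof.
  induction n as [n IH] using lt_wf_ind.
  destruct n as [|[|n]]; [reflexivity|simpl; ring|].
  assert (Hn : INR (S (S n)) <> 0) by (apply not_0_INR; lia).
  apply (Rmult_eq_reg_l (INR (S (S n)))); [|exact Hn].
  rewrite meixner_rec, (IH (S n)), (IH n) by lia.
  rewrite !S_INR. ring.
Qed.

(** Here [q^m = ((1 + t) / (1 - t))^(-m)]; the induction uses [(1 + t) q^(m+1) = (1 - t) q^m]. *)
Lemma qpar_pow_approx (N m : nat) :
  approx N (fun t => qpar t ^ m) (meixner 0 (- INR m)).
Proof.
  induction m as [|m IH].
  - apply (approx_ext N (fun _ => 1) _ (fun n => match n with O => 1 | S _ => 0 end)).
    + reflexivity.
    + intros n _. rewrite <- meixner_0_0. f_equal. simpl. ring.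
    + apply approx_const.
  - apply (approx_div N 1); [rewrite Rabs_R1; lra|].
    eapply approx_ext; [| |exact (approx_mul N (-1) _ _ IH)].
    + intros t Ht. unfold qpar. simpl. field. lra.
    + intros n _. rewrite <- meixner_contiguous. rewrite S_INR.
      now replace (- (INR m + 1) + 1) with (- INR m) by ring.
Qed.

(** * Finite differences and Euler's transformation on polynomials *)

Fixpoint diff (k : nat) (h : nat -> R) (n : nat) : R :=
  match k with O => h n | S k => diff k h (S n) - diff k h n end.

(* Partial sums of Euler's transformation of [2 * (h 0 - h 1 + h 2 - ...)]. *)
Fixpoint euler (K : nat) (h : nat -> R) : R :=
  match K with O => 0 | S K => euler K h + (-1 / 2) ^ K * diff K h 0 end.

Lemma diff_ext (k : nat) (g h : nat -> R) :
  (forall n, g n = h n) -> forall n, diff k g n = diff k h n.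
Proof.
  intros H. induction k as [|k IH]; intros n; simpl; [apply H|now rewrite !IH].
Qed.

Lemma diff_lin (k : nat) (g h : nat -> R) (x y : R) (n : nat) :
  diff k (fun i => x * g i + y * h i) n = x * diff k g n + y * diff k h n.
Proof.
  revert n; induction k as [|k IH]; intros n; simpl; [reflexivity|]. rewrite !IH. ring.
Qed.

Lemma diff_succ (k : nat) (h : nat -> R) (n : nat) :
  diff k (fun i => h (S i)) n = diff k h (S n).
Proof.
  revert n; induction k as [|k IH]; intros n; simpl; [reflexivity|]. now rewrite !IH.
Qed.

Lemma diff_S (k : nat) (h : nat -> R) (n : nat) :
  diff (S k) h n = diff k (fun i => h (S i) - h i) n.
Proof.
  rewrite (diff_ext k _ (fun i => 1 * h (S i) + -1 * h i)) by (intros; ring).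
  rewrite diff_lin, diff_succ. simpl. ring.
Qed.

Lemma euler_ext (K : nat) (g h : nat -> R) :
  (forall n, g n = h n) -> euler K g = euler K h.
Proof.
  intros H. induction K as [|K IH]; simpl; [reflexivity|].
  now rewrite IH, (diff_ext K g h).
Qed.

Lemma euler_lin (K : nat) (g h : nat -> R) (x y : R) :
  euler K (fun i => x * g i + y * h i) = x * euler K g + y * euler K h.
Proof.
  induction K as [|K IH]; simpl; [ring|]. rewrite IH, diff_lin. ring.
Qed.

(** Polynomial sequences are encoded by a vanishing difference, which is exactly what makes Euler's
    transformation a finite sum. *)
Definition degree_lt (K : nat) (h : nat -> R) : Prop := forall n, diff K h n = 0.

Lemma degree_lt_ext (K : nat) (g h : nat -> R) :
  (forall n, g n = h n) -> degree_lt K g -> degree_lt K h.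
Proof. intros H Hg n. rewrite <- (diff_ext K g h H). apply Hg. Qed.

Lemma degree_lt_le (K L : nat) (h : nat -> R) :
  (K <= L)%nat -> degree_lt K h -> degree_lt L h.
Proof.
  intros HKL Hh. induction HKL as [|L _ IH]; [exact Hh|].
  intros n. simpl. rewrite !IH. ring.
Qed.

Lemma degree_lt_lin (K : nat) (g h : nat -> R) (x y : R) :
  degree_lt K g -> degree_lt K h -> degree_lt K (fun i => x * g i + y * h i).
Proof. intros Hg Hh n. rewrite diff_lin, Hg, Hh. ring. Qed.

Lemma degree_lt_const (x : R) : degree_lt 1 (fun _ => x).
Proof. intros n. simpl. ring. Qed.

(** Leibniz rule: the difference of [(i + c) h(i)] is [(i + 1 + c)] times the difference of [h],
    plus [h(i)]. Since [c] changes, it is generalised in the induction. *)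
Lemma degree_lt_mul (K : nat) (c : R) (h : nat -> R) :
  degree_lt K h -> degree_lt (S K) (fun i => (INR i + c) * h i).
Proof.
  revert c h; induction K as [|K IH]; intros c h Hh.
  - intros n. unfold degree_lt in Hh. simpl in *. rewrite !Hh. ring.
  - intros n. rewrite diff_S.
    rewrite (diff_ext _ _ (fun i => 1 * ((INR i + (1 + c)) * (h (S i) - h i)) + 1 * h i))
      by (intros i; rewrite S_INR; ring).
    rewrite diff_lin, Hh, IH; [ring|].
    intros i. rewrite <- diff_S. apply Hh.
Qed.

Lemma euler_stable (K L : nat) (h : nat -> R) :
  (K <= L)%nat -> degree_lt K h -> euler L h = euler K h.
Proof.
  intros HKL Hh. induction HKL as [|L HKL IH]; [reflexivity|].
  simpl. rewrite IH, (degree_lt_le K L h HKL Hh 0%nat). ring.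
Qed.

(** The rule [L(h(i) + h(i+1)) = 2 h(0)]. For a truncated sum it holds up to a multiple of the next
    difference at 0, and that difference vanishes for polynomials. *)
Lemma euler_succ (K : nat) (h : nat -> R) :
  degree_lt K h -> euler K (fun i => h (S i)) = 2 * h O - euler K h.
Proof.
  intros Hh.
  enough (H : forall L, euler L (fun i => h (S i)) =
                        2 * h O - euler L h - 2 * ((-1 / 2) ^ L * diff L h 0)).
  { rewrite H, Hh. ring. }
  induction L as [|L IH]; [simpl; ring|].
  cbn [euler]. rewrite IH, diff_succ. simpl. field.
Qed.

(** [meixner c X n] has degree at most [n] in [X]. The hypothesis says that [X] has degree at most
    [d] in [i], through its effect as a multiplier; it is applied with [d = 1] and [d = 2]. *)
Lemma degree_lt_meixner (c : R) (X : nat -> R) (d : nat) :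
  (forall K h, degree_lt K h -> degree_lt (d + K) (fun i => X i * h i)) ->
  forall n, degree_lt (d * n + 1) (fun i => meixner c (X i) n).
Proof.
  intros HX n. induction n as [n IH] using lt_wf_ind.
  destruct n as [|[|n]].
  - rewrite Nat.mul_0_r. exact (degree_lt_const 1).
  - apply (degree_lt_ext _ (fun i => 2 * (X i * 1) + 1 * c)); [intros i; simpl; ring|].
    apply degree_lt_lin.
    + rewrite Nat.mul_1_r. apply HX, degree_lt_const.
    + apply (degree_lt_le 1); [lia|]. apply degree_lt_const.
  - assert (Hn : INR (S (S n)) <> 0) by (apply not_0_INR; lia).
    set (r := / INR (S (S n))).
    apply (degree_lt_ext _ (fun i => (2 * r) * (X i * meixner c (X i) (S n)) +
       1 * ((c * r) * meixner c (X i) (S n) + ((INR n + c) * r) * meixner c (X i) n))).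
    + intros i. apply (Rmult_eq_reg_l (INR (S (S n)))); [|exact Hn].
      rewrite meixner_rec. unfold r. field. exact Hn.
    + pose proof (IH (S n) ltac:(lia)) as H1. pose proof (IH n ltac:(lia)) as H2.
      apply degree_lt_lin; [|apply degree_lt_lin].
      * replace (d * S (S n) + 1)%nat with (d + (d * S n + 1))%nat by lia. now apply HX.
      * refine (degree_lt_le _ _ _ _ H1). nia.
      * refine (degree_lt_le _ _ _ _ H2). nia.
Qed.

Lemma degree_lt_meixner_INR (c : R) (n : nat) :
  degree_lt (n + 1) (fun i => meixner c (INR i) n).
Proof.
  replace (n + 1)%nat with (1 * n + 1)%nat by lia.
  apply degree_lt_meixner. intros K h Hh.
  apply (degree_lt_ext _ (fun i => (INR i + 0) * h i)); [intros; ring|].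
  now apply degree_lt_mul.
Qed.

(** With [p_k(i) = meixner c i k], contiguity reads [p_(k+1)(i+1) - p_k(i+1) = p_(k+1)(i) + p_k(i)].
    Applying [euler_succ] on the left and solving for the value at [p_(k+1)] gives the formula. *)
Lemma euler_meixner (c : R) (k K : nat) :
  (k + 2 <= K)%nat ->
  euler K (fun i => meixner c (INR i) (S k)) = meixner c 0 (S k) - meixner c 0 k.
Proof.
  intros HK.
  set (p := fun k i => meixner c (INR i) k).
  assert (D : forall j, (j <= S k)%nat -> degree_lt K (p j)).
  { intros j Hj. apply (degree_lt_le (j + 1)); [lia|apply degree_lt_meixner_INR]. }
  pose proof (euler_succ K _ (D (S k) ltac:(lia))) as H1.
  pose proof (euler_succ K _ (D k ltac:(lia))) as H0.
  assert (E : euler K (fun i => 1 * p (S k) (S i) + -1 * p k (S i)) =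
              euler K (fun i => 1 * p (S k) i + 1 * p k i)).
  { apply euler_ext. intros i. unfold p. rewrite S_INR.
    pose proof (meixner_contiguous c (INR i) (S k)) as Q. cbn [shift] in Q. lra. }
  rewrite !euler_lin, H1, H0 in E.
  unfold p in E at 1 3. cbv beta in E. change (INR 0) with 0 in E.
  fold (p (S k)). lra.
Qed.

Lemma euler_0th (K : nat) (x : R) : euler (S K) (fun _ => x) = x.
Proof.
  rewrite (euler_stable 1 (S K)) by (lia || apply degree_lt_const).
  simpl. ring.
Qed.

(** * The coefficients of f_b and their recursion *)

Definition expo (b i : nat) : R := - (INR i * (INR i + INR b)).

(* The coefficient of [t^n] in the expansion of [fb b]: the exponents of [q] are [- expo b i]. *)
Definition coef (b n : nat) : R := euler (2 * n + 1) (fun i => meixner 0 (expo b i) n).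

(** The exponent is quadratic in [i], so the degree is at most [2 n]; this explains the truncation
    in [coef]. *)
Lemma degree_lt_coef (b n : nat) : degree_lt (2 * n + 1) (fun i => meixner 0 (expo b i) n).
Proof.
  apply degree_lt_meixner. intros K h Hh.
  apply (degree_lt_ext _ (fun i => -1 * ((INR i + 0) * ((INR i + INR b) * h i)) + 0 * 0));
    [intros i; unfold expo; ring|].
  apply degree_lt_lin.
  - now do 2 apply degree_lt_mul.
  - apply (degree_lt_le 1); [lia|]. apply degree_lt_const.
Qed.

Lemma coef_stable (b n K : nat) : (2 * n + 1 <= K)%nat ->
  euler K (fun i => meixner 0 (expo b i) n) = coef b n.
Proof. intros HK. apply euler_stable; [exact HK|apply degree_lt_coef]. Qed.

(** A form of the recurrence that also covers [n = 0], where the last term carries the factor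
    [INR (pred 0) = 0]. *)
Lemma meixner_0_rec (X : R) (n : nat) :
  INR (S n) * meixner 0 X (S n) = 2 * X * meixner 0 X n + INR (pred n) * meixner 0 X (pred n).
Proof.
  destruct n as [|n]; [simpl; ring|]. rewrite meixner_rec. simpl pred. ring.
Qed.

(** Since [4 x (x + c) = (2 x + c)^2 - c^2] and multiplication by [2 x + c] moves the index by one
    either way, multiplication by [x (x + c)] preserves the parity of the index. *)
Lemma meixner_rec2 (c x : R) (k : nat) :
  4 * (x * (x + c)) * meixner c x (S (S k)) =
  (INR k + 3) * (INR k + 4) * meixner c x (S (S (S (S k))))
  - (c * c + (INR k + 3) * (INR k + 2 + c) + (INR k + 1 + c) * (INR k + 2)) * meixner c x (S (S k))
  + (INR k + 1 + c) * (INR k + c) * meixner c x k.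
Proof.
  pose proof (meixner_rec c x k) as H0.
  pose proof (meixner_rec c x (S k)) as H1.
  pose proof (meixner_rec c x (S (S k))) as H2.
  rewrite !S_INR in *.
  apply (f_equal (Rmult (INR k + 1 + c))) in H0.
  apply (f_equal (Rmult (2 * x + c))) in H1.
  apply (f_equal (Rmult (INR k + 3))) in H2.
  lra.
Qed.

(** The functional on [[t^n] q^(i^2 + b i)] times the [k]-th basis polynomial. The case [k = 0] is
    the coefficient sought, and lowering [n] spreads over neighbouring [k]. *)
Definition mixed (b K n k : nat) : R :=
  euler K (fun i => meixner 0 (expo b i) n * meixner (INR b) (INR i) k).

(** Uses [4 x (x + c) = 2 p_2(x) - c (1 + c)], the bottom case that the three-term formula does not
    reach. *)
Lemma mixed_step0 (b K n : nat) :
  INR (S n) * mixed b K (S n) 0 =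
  / 2 * (INR b * (1 + INR b) * mixed b K n 0 - 2 * mixed b K n 2)
  + INR (pred n) * mixed b K (pred n) 0.
Proof.
  transitivity (1 * euler K (fun i =>
      (INR b * (1 + INR b) / 2) * (meixner 0 (expo b i) n * meixner (INR b) (INR i) 0) +
      -1 * (meixner 0 (expo b i) n * meixner (INR b) (INR i) 2))
     + INR (pred n) * mixed b K (pred n) 0).
  - unfold mixed. rewrite <- euler_lin.
    (* A zero multiple is added to give the left side the two-term shape of [euler_lin]. *)
    replace (INR (S n) * _) with
        (INR (S n) * mixed b K (S n) 0 + 0 * euler K (fun i => 0)) by (unfold mixed; ring).
    unfold mixed. rewrite <- euler_lin. apply euler_ext. intros i.
    pose proof (meixner_0_rec (expo b i) n) as H1.
    pose proof (meixner_rec (INR b) (INR i) 0) as H2.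
    apply (f_equal (Rmult (meixner 0 (expo b i) n))) in H2.
    unfold expo in *. simpl (meixner _ _ 0) in *. simpl (meixner _ _ 1) in *.
    simpl (INR 2) in H2. simpl (INR 0) in H2. lra.
  - rewrite euler_lin. unfold mixed. field.
Qed.

(** [meixner_0_rec] combined with [meixner_rec2]. The same index enters with a nonnegative
    coefficient and its two neighbours with nonpositive ones, so sign patterns alternating in
    [k / 2] propagate. *)
Lemma mixed_step (b K n k : nat) :
  let c := INR b in let x := INR k in
  INR (S n) * mixed b K (S n) (S (S k)) =
  / 2 * ((c * c + (x + 3) * (x + 2 + c) + (x + 1 + c) * (x + 2)) * mixed b K n (S (S k))
         - (x + 3) * (x + 4) * mixed b K n (S (S (S (S k))))
         - (x + 1 + c) * (x + c) * mixed b K n k)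
  + INR (pred n) * mixed b K (pred n) (S (S k)).
Proof.
  intros c x.
  set (p := fun k i => meixner c (INR i) k).
  transitivity (1 * euler K (fun i =>
      ((c * c + (x + 3) * (x + 2 + c) + (x + 1 + c) * (x + 2)) / 2)
        * (meixner 0 (expo b i) n * p (S (S k)) i) +
      (- (x + 3) * (x + 4) / 2) * (meixner 0 (expo b i) n * p (S (S (S (S k)))) i))
    + 1 * euler K (fun i =>
      (- (x + 1 + c) * (x + c) / 2) * (meixner 0 (expo b i) n * p k i) +
      INR (pred n) * (meixner 0 (expo b i) (pred n) * p (S (S k)) i))).
  - rewrite <- euler_lin.
    replace (INR (S n) * _) with
        (INR (S n) * mixed b K (S n) (S (S k)) + 0 * euler K (fun i => 0)) by ring.
    unfold mixed. rewrite <- euler_lin. apply euler_ext. intros i.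
    pose proof (meixner_0_rec (expo b i) n) as H1.
    pose proof (meixner_rec2 c (INR i) k) as H2.
    fold x in H2. fold (p k i) (p (S (S k)) i) (p (S (S (S (S k)))) i) in H2.
    fold c. fold (p (S (S k)) i).
    apply (f_equal (Rmult (p (S (S k)) i))) in H1.
    apply (f_equal (Rmult (meixner 0 (expo b i) n))) in H2.
    unfold expo in *. fold c in H1, H2. fold c. lra.
  - rewrite !euler_lin. unfold mixed, p. fold c. field.
Qed.

Lemma mixed_0_S (b K k : nat) :
  (k + 2 <= K)%nat -> mixed b K 0 (S k) = meixner (INR b) 0 (S k) - meixner (INR b) 0 k.
Proof.
  intros HK. rewrite <- (euler_meixner (INR b) k K HK).
  apply euler_ext. intros i. change (meixner 0 (expo b i) 0) with 1. ring.
Qed.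

Lemma mixed_coef (b K n : nat) : (2 * n + 1 <= K)%nat -> mixed b K n 0 = coef b n.
Proof.
  intros HK. rewrite <- (coef_stable b n K HK).
  apply euler_ext. intros i. change (meixner _ _ 0) with 1. ring.
Qed.

Lemma coef_0 (b : nat) : coef b 0 = 1.
Proof. apply (euler_0th 0). Qed.

(** * The cases b = 0 and b = 1 *)

(** Induction on [n] through [mixed_step]. The bound on [K] is the same for [(n + 1, j)] and
    [(n, j + 1)], so it survives the step. *)
Lemma mixed_0_even (K n j : nat) :
  (2 * n + 2 * j + 3 <= K)%nat -> mixed 0 K n (S (S (2 * j))) = 0.
Proof.
  revert j; induction n as [n IH] using lt_wf_ind. intros j HK.
  destruct n as [|n].
  - rewrite mixed_0_S, !meixner_0_0 by lia. ring.
  - assert (Hn : INR (S n) <> 0) by (apply not_0_INR; lia).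
    apply (Rmult_eq_reg_l (INR (S n))); [|exact Hn].
    rewrite mixed_step.
    replace (S (S (S (S (2 * j))))) with (S (S (2 * S j))) by lia.
    rewrite (IH n ltac:(lia) (S j)), (IH n ltac:(lia) j) by lia.
    (* For [j = 0] the induction hypothesis says nothing about index 0, but for [b = 0] the
       coefficient [(x + 1) x] vanishes there. *)
    assert (H1 : INR (2 * j) * mixed 0 K n (2 * j) = 0).
    { destruct j as [|j]; [simpl; ring|].
      replace (2 * S j)%nat with (S (S (2 * j))) by lia.
      rewrite (IH n) by lia. ring. }
    assert (H2 : INR (pred n) * mixed 0 K (pred n) (S (S (2 * j))) = 0).
    { destruct n as [|n]; [simpl; ring|]. rewrite IH by (simpl; lia). ring. }
    change (INR 0) with 0. rewrite H2.
    apply (f_equal (Rmult (INR (2 * j) + 1))) in H1. lra.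
Qed.

Lemma coef_0_S (n : nat) : coef 0 (S n) = 0.
Proof.
  induction n as [n IH] using lt_wf_ind.
  set (K := (2 * S n + 3)%nat).
  assert (Hn : INR (S n) <> 0) by (apply not_0_INR; lia).
  apply (Rmult_eq_reg_l (INR (S n))); [|exact Hn].
  rewrite <- (mixed_coef 0 K), mixed_step0 by lia.
  change 2%nat with (S (S (2 * 0))) at 1. rewrite mixed_0_even by lia.
  (* For [n = 1] this involves [coef 0 0 = 1], which is killed by the factor [INR 0]. *)
  assert (H2 : INR (pred n) * mixed 0 K (pred n) 0 = 0).
  { destruct n as [|[|n]]; [simpl; ring|simpl; ring|].
    rewrite mixed_coef by (simpl; lia). simpl pred. rewrite IH by lia. ring. }
  rewrite H2. simpl. ring.
Qed.

(** At [n = 0] the value is 1 for index 0 and 0 otherwise, because [meixner 1 0] is constant. In the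
    step, the alternating signs cancel those of the coefficients in [mixed_step]. *)
Lemma mixed_1_even_sign (K n j : nat) :
  (2 * n + 2 * j + 3 <= K)%nat -> 0 <= (-1) ^ j * mixed 1 K n (2 * j).
Proof.
  revert j; induction n as [n IH] using lt_wf_ind. intros j HK.
  destruct n as [|n].
  - destruct j as [|j].
    + rewrite mixed_coef, coef_0 by lia. simpl. lra.
    + replace (2 * S j)%nat with (S (S (2 * j))) by lia.
      rewrite mixed_0_S, !meixner_1_0 by lia. lra.
  - assert (Hn : 0 < INR (S n)) by (apply lt_0_INR; lia).
    apply (Rmult_le_reg_l (INR (S n))); [exact Hn|]. rewrite Rmult_0_r.
    assert (H2 : 0 <= (-1) ^ j * (INR (pred n) * mixed 1 K (pred n) (2 * j))).
    { destruct n as [|n]; [simpl; lra|].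
      assert (H := IH n ltac:(lia) j ltac:(lia)). simpl pred.
      pose proof (pos_INR n). nra. }
    destruct j as [|j].
    + change (2 * 0)%nat with 0%nat in *.
      pose proof (IH n ltac:(lia) 0%nat ltac:(lia)) as E0.
      pose proof (IH n ltac:(lia) 1%nat ltac:(lia)) as E1.
      simpl in E0, E1.
      replace (INR (S n) * _) with (INR (S n) * mixed 1 K (S n) 0) by (simpl; ring).
      rewrite mixed_step0. simpl (INR 1). simpl ((-1) ^ 0) in H2. lra.
    + replace (2 * S j)%nat with (S (S (2 * j))) in * by lia.
      pose proof (IH n ltac:(lia) j ltac:(lia)) as E0.
      pose proof (IH n ltac:(lia) (S j) ltac:(lia)) as E1.
      pose proof (IH n ltac:(lia) (S (S j)) ltac:(lia)) as E2.
      replace (2 * S (S j))%nat with (S (S (S (S (2 * j))))) in E2 by lia.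
      replace (2 * S j)%nat with (S (S (2 * j))) in E1 by lia.
      replace (INR (S n) * _) with
        ((-1) ^ S j * (INR (S n) * mixed 1 K (S n) (S (S (2 * j))))) by ring.
      rewrite mixed_step. simpl (INR 1).
      set (x := INR (2 * j)). assert (Hx : 0 <= x) by apply pos_INR.
      simpl pow in *.
      set (s := (-1) ^ j) in *.
      assert (F0 : 0 <= (x + 2) * (x + 1) * (s * mixed 1 K n (2 * j))).
      { apply Rmult_le_pos; [nra|exact E0]. }
      assert (F1 : 0 <= (1 + (x + 3) * (x + 3) + (x + 2) * (x + 2))
                        * (-1 * s * mixed 1 K n (S (S (2 * j))))).
      { apply Rmult_le_pos; [nra|exact E1]. }
      assert (F2 : 0 <= (x + 3) * (x + 4)
                        * (-1 * (-1 * s) * mixed 1 K n (S (S (S (S (2 * j))))))).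
      { apply Rmult_le_pos; [nra|exact E2]. }
      lra.
Qed.

(** Since the mixed value at index 2 is nonpositive, [mixed_step0] gives
    [(n + 1) coef 1 (n + 1) >= coef 1 n]. *)
Lemma coef_1_pos (n : nat) : 0 < coef 1 n.
Proof.
  induction n as [n IH] using lt_wf_ind.
  destruct n as [|n]; [rewrite coef_0; lra|].
  set (K := (2 * S n + 3)%nat).
  apply (Rmult_lt_reg_l (INR (S n))); [apply lt_0_INR; lia|]. rewrite Rmult_0_r.
  rewrite <- (mixed_coef 1 K), mixed_step0, !mixed_coef by lia.
  pose proof (IH n ltac:(lia)) as H0.
  pose proof (mixed_1_even_sign K n 1 ltac:(lia)) as H1. simpl in H1.
  assert (H2 := Rmult_le_pos _ _ (pos_INR (pred n)) (Rlt_le _ _ (IH (pred n) ltac:(lia)))).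
  simpl (INR 1). lra.
Qed.

Lemma coef_1_1 : coef 1 1 = 1.
Proof. unfold coef, expo. simpl. field. Qed.

(** * The remainder of Euler's transformation *)

Lemma ex_series_alt (h : nat -> R) :
  ex_series (fun n => Rabs (h n)) -> ex_series (fun n => (-1) ^ n * h n).
Proof.
  intros H. apply ex_series_Rabs. eapply ex_series_ext; [|exact H].
  intros n. now rewrite Rabs_mult, pow_1_abs, Rmult_1_l.
Qed.

Lemma ex_series_diff (K : nat) (h : nat -> R) :
  ex_series (fun n => Rabs (h n)) -> ex_series (fun n => Rabs (diff K h n)).
Proof.
  intros H. induction K as [|K IH]; [exact H|].
  apply (ex_series_le (K := R_AbsRing) (V := R_CompleteNormedModule) _
           (fun n => Rabs (diff K h (S n)) + Rabs (diff K h n))).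
  - intros n. change norm with Rabs. rewrite Rabs_Rabsolu. simpl.
    eapply Rle_trans; [apply Rabs_triang|]. rewrite Rabs_Ropp. lra.
  - apply (ex_series_plus (K := R_AbsRing) (V := R_NormedModule)); [|exact IH].
    now apply (ex_series_incr_1 (fun n => Rabs (diff K h n))).
Qed.

(** One step of Euler's transformation: the alternating series is averaged with its shift. *)
Lemma Series_alt_step (h : nat -> R) :
  ex_series (fun n => Rabs (h n)) ->
  2 * Series (fun n => (-1) ^ n * h n) =
  h O - Series (fun n => (-1) ^ n * (h (S n) - h n)).
Proof.
  intros H. set (a := fun n => (-1) ^ n * h n).
  assert (Ha : ex_series a) by now apply ex_series_alt.
  assert (Ha' : ex_series (fun n => a (S n))) by now apply (ex_series_incr_1 a).
  rewrite (Series_ext (fun n => (-1) ^ n * (h (S n) - h n)) (fun n => - (a (S n) + a n)))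
    by (intros n; unfold a; simpl; ring).
  rewrite Series_opp, Series_plus by assumption.
  replace (h O) with (a O) by (unfold a; simpl; ring).
  rewrite (Series_incr_1 a Ha). ring.
Qed.

Lemma Series_alt_euler (K : nat) (h : nat -> R) :
  ex_series (fun n => Rabs (h n)) ->
  2 * Series (fun n => (-1) ^ n * h n) =
  euler K h + (-1 / 2) ^ K * (2 * Series (fun n => (-1) ^ n * diff K h n)).
Proof.
  intros H. induction K as [|K IH]; [simpl; ring|].
  rewrite IH, (Series_alt_step (diff K h)) by now apply ex_series_diff.
  simpl. field.
Qed.

(** [G k] is the [k]-th derivative of [G 0]. The induction replaces the whole family by
    [G k (x + 1) - G k x]; the mean value theorem bounds it by a derivative at some point of
    [[x, x + 1]], where the decreasing [B] is at most [B x]. *)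
Lemma diff_le_derive (K : nat) (G : nat -> R -> R) (B : R -> R) :
  (forall k x, is_derive (G k) x (G (S k) x)) ->
  (forall x y, 0 <= x <= y -> B y <= B x) ->
  (forall x, 0 <= x -> Rabs (G K x) <= B x) ->
  forall n, Rabs (diff K (fun i => G O (INR i)) n) <= B (INR n).
Proof.
  revert G; induction K as [|K IH]; intros G HG HB HK n; [apply HK, pos_INR|].
  rewrite diff_S.
  rewrite (diff_ext K _ (fun i => (fun k x => G k (x + 1) - G k x) O (INR i)))
    by (intros i; now rewrite S_INR).
  apply (IH (fun k x => G k (x + 1) - G k x)); [|exact HB|].
  - intros k x. auto_derive.
    + split; [eexists; apply HG|split; [eexists; apply HG|exact I]].
    + rewrite !(is_derive_unique _ _ _ (HG k _)). ring.
  - intros x Hx.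
    destruct (MVT_gen (G K) x (x + 1) (G (S K))) as (y & Hy & E).
    + intros y _. apply HG.
    + intros y _. apply continuity_pt_filterlim, (ex_derive_continuous (G K)).
      eexists. apply HG.
    + rewrite Rmin_left, Rmax_right in Hy by lra.
      rewrite E. replace (x + 1 - x) with 1 by ring. rewrite Rmult_1_r.
      eapply Rle_trans; [apply HK; lra|]. apply HB. lra.
Qed.

(* [hermite k v * exp (- v^2)] is the [k]-th derivative of [exp (- v^2)]. *)
Fixpoint hermite (k : nat) (v : R) : R :=
  match k with
  | O => 1
  | S m => match m with
           | O => -2 * v
           | S l => -2 * v * hermite m v - 2 * INR m * hermite l v
           end
  end.

Lemma hermite_SS (k : nat) (v : R) :
  hermite (S (S k)) v = -2 * v * hermite (S k) v - 2 * INR (S k) * hermite k v.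
Proof. reflexivity. Qed.

(** Equivalent to saying that [hermite k v * exp (- v^2)] has derivative
    [hermite (S k) v * exp (- v^2)]. *)
Lemma is_derive_hermite (k : nat) (v : R) :
  is_derive (hermite k) v (hermite (S k) v + 2 * v * hermite k v).
Proof.
  revert v; induction k as [k IH] using lt_wf_ind; intros v.
  destruct k as [|[|k]].
  - simpl. auto_derive; [exact I|ring].
  - simpl. auto_derive; [exact I|ring].
  - apply (is_derive_ext (fun v => -2 * v * hermite (S k) v - 2 * INR (S k) * hermite k v));
      [intros; now rewrite hermite_SS|].
    pose proof (IH (S k) ltac:(lia) v) as H1. pose proof (IH k ltac:(lia) v) as H0.
    evar_last.
    + apply (is_derive_minus (fun v => -2 * v * hermite (S k) v)
                             (fun v => 2 * INR (S k) * hermite k v)).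
      * apply (is_derive_mult (fun v => -2 * v) (hermite (S k))); [|exact H1|intros; apply Rmult_comm].
        apply (is_derive_scal (fun v => v)). apply @is_derive_id.
      * apply (is_derive_scal (hermite k)). exact H0.
    + rewrite !hermite_SS, (S_INR (S k)).
      generalize (hermite (S k) v) (hermite k v) (INR (S k)). intros x y z.
      unfold minus, plus, opp, mult, one; simpl.
      ring.
Qed.

Lemma hermite_bound (k : nat) :
  exists A : R, 0 <= A /\ forall v, Rabs (hermite k v) <= A * (1 + v * v) ^ k.
Proof.
  induction k as [k IH] using lt_wf_ind.
  assert (Hv : forall v, Rabs v <= 1 + v * v).
  { intros v. apply Rabs_le. nra. }
  destruct k as [|[|k]].
  - exists 1. split; [lra|]. intros v. simpl. rewrite Rabs_R1. lra.
  - exists 2. split; [lra|]. intros v. simpl.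
    rewrite Rabs_mult, (Rabs_left (-2)) by lra. pose proof (Hv v). lra.
  - destruct (IH (S k) ltac:(lia)) as (A1 & HA1 & H1).
    destruct (IH k ltac:(lia)) as (A0 & HA0 & H0).
    pose proof (pos_INR (S k)) as Hk.
    exists (2 * A1 + 2 * INR (S k) * A0). split; [nra|]. intros v.
    specialize (H1 v). specialize (H0 v). specialize (Hv v).
    rewrite hermite_SS.
    unfold Rminus. eapply Rle_trans; [apply Rabs_triang|].
    rewrite Rabs_Ropp, !Rabs_mult, (Rabs_pos_eq (INR (S k))) by exact Hk.
    rewrite (Rabs_left (-2)), (Rabs_pos_eq 2) by lra.
    set (w := 1 + v * v) in *. assert (Hw : 1 <= w) by (unfold w; nra).
    assert (Hp : 1 <= w ^ k) by now apply pow_R1_Rle.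
    assert (E1 : Rabs v * Rabs (hermite (S k) v) <= w * (A1 * w ^ S k)).
    { apply Rmult_le_compat; auto using Rabs_pos. }
    assert (E0 : INR (S k) * Rabs (hermite k v) <= INR (S k) * (A0 * w ^ k)).
    { now apply Rmult_le_compat_l. }
    assert (E2 : INR (S k) * (A0 * w ^ k) <= INR (S k) * (A0 * (w * (w * w ^ k)))).
    { do 2 (apply Rmult_le_compat_l; [assumption|]).
      assert (1 <= w * w) by nra. nra. }
    simpl pow in *. lra.
Qed.

Lemma exp_le_compat (x y : R) : x <= y -> exp x <= exp y.
Proof. intros [H| ->]; [left; now apply exp_increasing|right; reflexivity]. Qed.

Lemma pow_le_exp (j : nat) (w : R) : 0 <= w -> w ^ j <= INR (fact j) * exp w.
Proof.
  intros Hw. pose proof (lt_0_INR _ (lt_O_fact j)) as Hj.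
  assert (H : w ^ j / INR (fact j) <= exp w).
  { eapply Rle_trans; [|apply (exp_ge_taylor w j Hw)].
    assert (T : forall k, 0 <= w ^ k / INR (fact k)).
    { intros k. apply Rle_mult_inv_pos; [now apply pow_le|].
      apply lt_0_INR, lt_O_fact. }
    destruct j as [|j]; [right; reflexivity|].
    rewrite tech5. pose proof (cond_pos_sum _ j T). lra. }
  apply (Rmult_le_compat_l (INR (fact j))) in H; [|lra].
  replace (INR (fact j) * (w ^ j / INR (fact j))) with (w ^ j) in H by (field; lra).
  exact H.
Qed.

(** With [w = 1 + v^2], the polynomial is [O(w^k)], while [w^(k+1) <= (k+1)! exp w] and
    [exp w * exp (- v^2)] is the constant [exp 1]. *)
Lemma gauss_hermite_bound (k : nat) :
  exists A : R, 0 <= A /\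
    forall v, Rabs (hermite k v) * exp (- (v * v)) <= A / (1 + v * v).
Proof.
  destruct (hermite_bound k) as (A & HA & H).
  set (c := INR (fact (S k)) * exp 1).
  assert (Hc : 0 <= c).
  { apply Rmult_le_pos; [apply pos_INR|apply Rlt_le, exp_pos]. }
  exists (A * c). split; [nra|]. intros v.
  set (w := 1 + v * v). assert (Hw : 1 <= w) by (unfold w; nra).
  pose proof (pow_le_exp (S k) w ltac:(lra)) as P.
  assert (E : exp w * exp (- (v * v)) = exp 1).
  { rewrite <- exp_plus. f_equal. unfold w. ring. }
  pose proof (exp_pos (- (v * v))) as He.
  apply (Rmult_le_reg_r w); [lra|].
  replace (A * c / w * w) with (A * c) by (field; lra).
  specialize (H v). fold w in H.
  apply (Rmult_le_compat_r (exp (- (v * v)) * w)) in H; [|nra].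
  apply (Rmult_le_compat_r (exp (- (v * v)))) in P; [|lra].
  rewrite Rmult_assoc, E in P. fold c in P.
  apply (Rmult_le_compat_l A) in P; [|exact HA].
  simpl pow in P. lra.
Qed.

(* The [k]-th derivative of [exp (- r^2 (x^2 + b x))], by completing the square. *)
Definition gauss (b r : R) (k : nat) (x : R) : R :=
  r ^ k * hermite k (r * (x + b / 2)) * exp (- (r * r * (x * x + b * x))).

Lemma is_derive_gauss (b r : R) (k : nat) (x : R) :
  is_derive (gauss b r k) x (gauss b r (S k) x).
Proof.
  unfold gauss. set (v := r * (x + b / 2)).
  pose proof (is_derive_hermite k v) as H.
  auto_derive.
  - eexists. exact H.
  - change (fun y => hermite k y) with (hermite k). fold v.
    rewrite (is_derive_unique _ _ _ H).
    replace (r ^ S k) with (r * r ^ k) by reflexivity.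
    unfold v. generalize (hermite (S k) (r * (x + b / 2))). intros. field.
Qed.

(** Two of the [k + 2] powers of [r] are spent on turning [1 / (1 + v^2)] into [1 / (1 + x^2)],
    which is summable over the integers uniformly in [r]. The factor [exp (b^2 / 4)] comes from
    completing the square with [r <= 1]. *)
Lemma gauss_bound (b : R) (k : nat) : 0 <= b ->
  exists A : R, 0 <= A /\ forall r x, 0 < r <= 1 -> 0 <= x ->
    Rabs (gauss b r (S (S k)) x) <= A * r ^ k * / (1 + x * x).
Proof.
  intros Hb. destruct (gauss_hermite_bound (S (S k))) as (A & HA & H).
  exists (A * exp (b * b / 4)).
  split; [pose proof (exp_pos (b * b / 4)); nra|].
  intros r x Hr Hx. unfold gauss.
  set (v := r * (x + b / 2)) in *.
  assert (Hp : 0 < r ^ k) by (apply pow_lt; lra).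
  assert (Hv : r * r * (1 + x * x) <= 1 + v * v).
  { assert (H1 : 0 <= r * x) by nra. assert (H2 : r * x <= v) by (unfold v; nra).
    pose proof (Rmult_le_compat _ _ _ _ H1 H1 H2 H2). nra. }
  assert (He : exp (- (r * r * (x * x + b * x))) <= exp (- (v * v)) * exp (b * b / 4)).
  { rewrite <- exp_plus. apply exp_le_compat. unfold v.
    assert (0 <= (1 - r * r) * (b * b)) by (apply Rmult_le_pos; nra). lra. }
  rewrite !Rabs_mult, (Rabs_pos_eq (r ^ _)), (Rabs_pos_eq (exp _))
    by (apply Rlt_le, exp_pos || (apply pow_le; lra)).
  specialize (H v).
  apply Rle_trans with (r ^ S (S k) * (A / (1 + v * v) * exp (b * b / 4))).
  - rewrite Rmult_assoc. apply Rmult_le_compat_l; [apply pow_le; lra|].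
    eapply Rle_trans; [apply Rmult_le_compat_l; [apply Rabs_pos|exact He]|].
    rewrite <- Rmult_assoc. apply Rmult_le_compat_r; [apply Rlt_le, exp_pos|exact H].
  - simpl pow.
    replace (r * (r * r ^ k) * (A / (1 + v * v) * exp (b * b / 4))) with
      (A * exp (b * b / 4) * r ^ k * (r * r / (1 + v * v))) by (field; nra).
    apply Rmult_le_compat_l.
    + pose proof (exp_pos (b * b / 4)). repeat apply Rmult_le_pos; lra.
    + apply (Rmult_le_reg_r (1 + v * v)); [nra|].
      apply (Rmult_le_reg_r (1 + x * x)); [nra|].
      replace (r * r / (1 + v * v) * (1 + v * v) * (1 + x * x)) with
        (r * r * (1 + x * x)) by (field; nra).
      replace (/ (1 + x * x) * (1 + v * v) * (1 + x * x)) with (1 + v * v) by (field; nra).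
      exact Hv.
Qed.

Lemma ex_series_inv_sq : ex_series (fun n => / (1 + INR n * INR n)).
Proof.
  apply (ex_series_le (K := R_AbsRing) (V := R_CompleteNormedModule) _
           (fun n => 4 * / ((INR n + 1) * (INR n + 2)))).
  - intros n. change norm with Rabs. pose proof (pos_INR n) as Hn.
    rewrite Rabs_pos_eq by (apply Rlt_le, Rinv_0_lt_compat; nra).
    apply (Rmult_le_reg_r (1 + INR n * INR n)); [nra|].
    rewrite Rinv_l by nra.
    apply (Rmult_le_reg_r ((INR n + 1) * (INR n + 2))); [nra|].
    replace (4 * / ((INR n + 1) * (INR n + 2)) * (1 + INR n * INR n) *
      ((INR n + 1) * (INR n + 2))) with (4 * (1 + INR n * INR n)) by (field; lra).
    nra.
  - apply (ex_series_scal_l 4 (fun n => / ((INR n + 1) * (INR n + 2)))).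
    exists 1. change (is_lim_seq (sum_n (fun n => / ((INR n + 1) * (INR n + 2)))) 1).
    apply (is_lim_seq_ext (fun n => 1 - / (INR n + 2))).
    + intros n. induction n as [|n IH].
      * rewrite sum_O. simpl. field.
      * rewrite sum_Sn, <- IH, S_INR. pose proof (pos_INR n).
        unfold plus; simpl. field. lra.
    + replace (Finite 1) with (Finite (1 - 0)) by (f_equal; ring).
      apply is_lim_seq_minus'; [apply is_lim_seq_const|].
      apply (is_lim_seq_inv _ p_infty); [|discriminate].
      apply (is_lim_seq_plus _ _ p_infty 2); [apply is_lim_seq_INR|apply is_lim_seq_const|].
      reflexivity.
Qed.

(** * The asymptotic expansion of f_b *)

Lemma approx_diff (N k : nat) (h : nat -> R -> R) (a : nat -> nat -> R) :
  (forall i, approx N (h i) (a i)) ->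
  forall j, approx N (fun t => diff k (fun i => h i t) j) (fun n => diff k (fun i => a i n) j).
Proof.
  intros H. induction k as [|k IH]; intros j; [apply H|].
  eapply approx_ext; [| |exact (approx_lin N _ _ _ _ 1 (-1) (IH (S j)) (IH j))];
    intros; simpl; ring.
Qed.

Lemma approx_euler (N K : nat) (h : nat -> R -> R) (a : nat -> nat -> R) :
  (forall i, approx N (h i) (a i)) ->
  approx N (fun t => euler K (fun i => h i t)) (fun n => euler K (fun i => a i n)).
Proof.
  intros H. induction K as [|K IH].
  - eapply approx_ext; [| |exact (approx_lin N _ _ _ _ 0 0 (H O) (H O))];
      intros; simpl; ring.
  - eapply approx_ext;
      [| |exact (approx_lin N _ _ _ _ 1 ((-1 / 2) ^ K) IH (approx_diff N K h a H O))];
      intros; simpl; ring.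
Qed.

Lemma qpar_bounds (t : R) : 0 < t < 1 -> 0 < qpar t < 1.
Proof.
  intros Ht. unfold qpar. split; [apply Rdiv_lt_0_compat; lra|].
  apply (Rmult_lt_reg_r (1 + t)); [lra|].
  unfold Rdiv. rewrite Rmult_assoc, Rinv_l by lra. lra.
Qed.

Lemma pow_le_1 (x : R) (n : nat) : 0 <= x <= 1 -> x ^ n <= 1.
Proof. intros H. rewrite <- (pow1 n). now apply pow_incr. Qed.

Lemma ex_series_fb (b : nat) (t : R) : 0 < t < 1 ->
  ex_series (fun n => Rabs (qpar t ^ (n * n + b * n))).
Proof.
  intros Ht. pose proof (qpar_bounds t Ht) as Hq.
  apply (ex_series_le (K := R_AbsRing) (V := R_CompleteNormedModule) _ (fun n => qpar t ^ n)).
  - intros n. change norm with Rabs.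
    rewrite Rabs_Rabsolu, Rabs_pos_eq by (apply pow_le; lra).
    replace (n * n + b * n)%nat with (n + (n * (n - 1) + b * n))%nat by nia.
    rewrite pow_add. rewrite <- (Rmult_1_r (qpar t ^ n)) at 2.
    apply Rmult_le_compat_l; [apply pow_le; lra|apply pow_le_1; lra].
  - apply ex_series_geom. rewrite Rabs_pos_eq; lra.
Qed.

Lemma fb_pow_gauss (b : nat) (t r : R) (i : nat) : 0 < qpar t -> r * r = - ln (qpar t) ->
  qpar t ^ (i * i + b * i) = gauss (INR b) r 0 (INR i).
Proof.
  intros Hq Hr. rewrite <- Rpower_pow by exact Hq.
  unfold Rpower, gauss. rewrite Hr, plus_INR, !mult_INR. simpl.
  rewrite !Rmult_1_l. f_equal. ring.
Qed.

(** The finite Euler sum is a combination of powers of [q], each with a known expansion. The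
    remainder is an alternating series of [K]-th differences of a Gaussian of scale
    [r = sqrt (- ln q)], of size [O(r^(2(N+1))) = O(t^(N+1))]. *)
Lemma fb_expansion (b : nat) : asymp_expansion (fb b) (coef b).
Proof.
  (* Each two differences gain a factor of order [t]; the two extra ones pay for summability in
     [gauss_bound]. *)
  intros N. set (K := S (S (2 * (N + 1)))).
  set (g := fun (i : nat) (t : R) => qpar t ^ (i * i + b * i)).
  assert (HE : approx N (fun t => euler K (fun i => g i t)) (coef b)).
  { eapply approx_ext;
      [| |apply (approx_euler N K g (fun i => meixner 0 (expo b i)))].
    - reflexivity.
    - intros n Hn. apply coef_stable. unfold K. lia.
    - intros i. eapply approx_ext; [| |apply (qpar_pow_approx N (i * i + b * i))].
      + reflexivity.
      + intros n _. f_equal. unfold expo. rewrite plus_INR, !mult_INR. ring. }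
  destruct (gauss_bound (INR b) (2 * (N + 1)) (pos_INR b)) as (A & HA & HG).
  fold K in HG.
  set (S0 := Series (fun n => / (1 + INR n * INR n))).
  destruct HE as (C & d & Hd & HE).
  exists (C + 2 * A * 4 ^ (N + 1) * S0), (Rmin d (1 / 4)).
  split; [apply Rmin_glb_lt; lra|].
  intros t Ht Ht1.
  assert (Htd : 0 < t < d) by (pose proof (Rmin_l d (1 / 4)); lra).
  assert (Ht4 : t < 1 / 4) by (pose proof (Rmin_r d (1 / 4)); lra).
  specialize (HE t Htd Ht1).
  set (P := sum_f_R0 _ N) in *.
  pose proof (qpar_bounds t ltac:(lra)) as Hq.
  set (s := - ln (qpar t)).
  assert (Hs0 : 0 < s).
  { pose proof (ln_increasing _ _ (proj1 Hq) (proj2 Hq)) as H. rewrite ln_1 in H.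
    unfold s. lra. }
  (* From [1 + s <= exp s = 1 / q <= 1 + 4 t]. With [t < 1/4] this also yields [r <= 1]. *)
  assert (Hs : s <= 4 * t).
  { pose proof (exp_ineq1_le s) as H. unfold s at 2 in H.
    rewrite exp_Ropp, exp_ln in H by lra.
    assert (/ qpar t <= 1 + 4 * t); [|lra].
    unfold qpar. apply (Rmult_le_reg_r (1 - t)); [lra|].
    replace (/ ((1 - t) / (1 + t)) * (1 - t)) with (1 + t) by (field; lra). nra. }
  set (r := sqrt s).
  assert (Hrr : r * r = s) by (apply sqrt_sqrt; lra).
  assert (Hr : 0 < r <= 1).
  { split; [now apply sqrt_lt_R0|]. rewrite <- sqrt_1. apply sqrt_le_1_alt. lra. }
  assert (HD : forall n, Rabs (diff K (fun i => g i t) n) <=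
                         A * r ^ (2 * (N + 1)) * / (1 + INR n * INR n)).
  { intros n.
    rewrite (diff_ext K _ (fun i => gauss (INR b) r 0 (INR i)))
      by (intros i; unfold g; now apply fb_pow_gauss).
    apply (diff_le_derive K (gauss (INR b) r)
             (fun x => A * r ^ (2 * (N + 1)) * / (1 + x * x))).
    - intros k x. apply is_derive_gauss.
    - intros x y Hxy. apply Rmult_le_compat_l.
      + apply Rmult_le_pos; [exact HA|apply pow_le; lra].
      + apply Rinv_le_contravar; nra.
    - intros x Hx. now apply HG. }
  rewrite pow_mult in HD. replace (r ^ 2) with s in HD by (rewrite <- Hrr; ring).
  assert (Hex : ex_series (fun n => Rabs (g n t))) by (apply ex_series_fb; lra).
  assert (HR : Rabs (Series (fun n => (-1) ^ n * diff K (fun i => g i t) n)) <=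
               A * s ^ (N + 1) * S0).
  { eapply Rle_trans.
    - apply Series_Rabs. eapply ex_series_ext; [|exact (ex_series_diff K _ Hex)].
      intros n. cbv beta. now rewrite Rabs_mult, pow_1_abs, Rmult_1_l.
    - unfold S0. rewrite <- Series_scal_l. apply Series_le.
      + intros n. split; [apply Rabs_pos|].
        rewrite Rabs_mult, pow_1_abs, Rmult_1_l. apply HD.
      + exact (ex_series_scal_l (A * s ^ (N + 1)) _ ex_series_inv_sq). }
  assert (HS0 : 0 <= S0).
  { unfold S0. rewrite <- (Rmult_0_l (Series (fun n => / (1 + INR n * INR n)))).
    rewrite <- Series_scal_l. apply Series_le; [|apply ex_series_inv_sq].
    intros n. rewrite Rmult_0_l. split; [lra|].
    pose proof (pos_INR n). apply Rlt_le, Rinv_0_lt_compat. nra. }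
  assert (Hsp : s ^ (N + 1) <= 4 ^ (N + 1) * t ^ (N + 1)).
  { rewrite <- Rpow_mult_distr. apply pow_incr. lra. }
  assert (Hfb : fb b t = euler K (fun i => g i t) +
    (-1 / 2) ^ K * (2 * Series (fun n => (-1) ^ n * diff K (fun i => g i t) n)))
    by (unfold fb; now apply Series_alt_euler).
  rewrite Hfb.
  set (R0 := Series (fun n => (-1) ^ n * _)) in *. set (E0 := euler K _) in *.
  replace (E0 + (-1 / 2) ^ K * (2 * R0) - P) with ((E0 - P) + (-1 / 2) ^ K * (2 * R0)) by ring.
  eapply Rle_trans; [apply Rabs_triang|].
  rewrite !Rabs_mult, (Rabs_pos_eq 2), <- RPow_abs by lra.
  assert (HK : Rabs (-1 / 2) ^ K <= 1).
  { apply pow_le_1. split; [apply Rabs_pos|]. apply Rabs_le. lra. }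
  assert (H0 : Rabs (-1 / 2) ^ K * (2 * Rabs R0) <= 1 * (2 * Rabs R0)).
  { apply Rmult_le_compat_r; [|exact HK]. pose proof (Rabs_pos R0). lra. }
  assert (H1 : A * S0 * s ^ (N + 1) <= A * S0 * (4 ^ (N + 1) * t ^ (N + 1))).
  { apply Rmult_le_compat_l; [now apply Rmult_le_pos|exact Hsp]. }
  lra.
Qed.

Lemma fb_shift (b : nat) (t : R) : 0 < t < 1 ->
  qpar t ^ (b + 1) * fb (b + 2) t = 2 - fb b t.
Proof.
  intros Ht. unfold fb.
  assert (H : ex_series (fun n => (-1) ^ n * qpar t ^ (n * n + b * n)))
    by (apply ex_series_alt, ex_series_fb, Ht).
  rewrite (Series_incr_1 _ H).
  rewrite (Series_ext (fun k => (-1) ^ S k * qpar t ^ (S k * S k + b * S k))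
    (fun n => - qpar t ^ (b + 1) * ((-1) ^ n * qpar t ^ (n * n + (b + 2) * n)))).
  - rewrite Series_scal_l. rewrite !Nat.mul_0_r. simpl. ring.
  - intros n.
    replace (S n * S n + b * S n)%nat with ((b + 1) + (n * n + (b + 2) * n))%nat by lia.
    rewrite (pow_add _ (b + 1)). simpl. ring.
Qed.

(** * The recursion in b *)

(** Here [s] is the sign [1] or [-1]. A uniform bound [c > 0], rather than mere positivity, makes
    partial sums grow linearly. *)
Definition eventually_ge (s : R) (a : nat -> R) : Prop :=
  exists (c : R) (N0 : nat), 0 < c /\ forall n, (N0 <= n)%nat -> c <= s * a n.

Lemma eventually_ge_ext (s : R) (a b : nat -> R) :
  (forall n, a n = b n) -> eventually_ge s a -> eventually_ge s b.
Proof.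
  intros E (c & N0 & Hc & H). exists c, N0. split; [exact Hc|].
  intros n Hn. rewrite <- E. now apply H.
Qed.

Lemma eventually_ge_shift (s : R) (a : nat -> R) :
  eventually_ge s a -> eventually_ge s (shift 1 a).
Proof.
  intros (c & N0 & Hc & H). exists c, (S N0). split; [exact Hc|].
  intros [|n] Hn; [lia|]. simpl.
  pose proof (H (S n) ltac:(lia)). pose proof (H n ltac:(lia)). lra.
Qed.

(** Linear growth of the partial sums overcomes the constant [x] and the finitely many initial
    terms. *)
Lemma eventually_ge_sum (s x : R) (a : nat -> R) :
  eventually_ge s a -> eventually_ge s (fun n => x + sum_f_R0 a n).
Proof.
  intros (c & N0 & Hc & H).
  set (y := s * (x + sum_f_R0 a N0)).
  assert (L : forall k, y + c * INR k <= s * (x + sum_f_R0 a (N0 + k))).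
  { induction k as [|k IH]; [rewrite Nat.add_0_r; unfold y; simpl; lra|].
    rewrite Nat.add_succ_r, tech5, S_INR.
    pose proof (H (S (N0 + k)) ltac:(lia)). lra. }
  destruct (INR_unbounded ((c - y) / c)) as (k0 & Hk0).
  exists c, (N0 + k0)%nat. split; [exact Hc|]. intros n Hn.
  replace n with (N0 + (n - N0))%nat by lia.
  eapply Rle_trans; [|apply L].
  assert (Hk : INR k0 <= INR (n - N0)) by (apply le_INR; lia).
  apply (Rmult_lt_compat_l c) in Hk0; [|exact Hc].
  replace (c * ((c - y) / c)) with (c - y) in Hk0 by (field; lra).
  apply (Rmult_le_compat_l c) in Hk; lra.
Qed.

(* Dividing by [q] multiplies the expansion by [(1 + t) / (1 - t)]. *)
Lemma asymp_expansion_div_qpar (k : nat) (F : R -> R) (a : nat -> R) :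
  asymp_expansion (fun t => qpar t ^ S k * F t) a ->
  asymp_expansion (fun t => qpar t ^ k * F t) (shift 1 (sum_f_R0 a)).
Proof.
  intros H N. apply (approx_div N (-1)); [rewrite Rabs_left; lra|].
  eapply approx_ext; [| |exact (approx_mul N 1 _ _ (H N))].
  - intros t Ht. unfold qpar. simpl. field. lra.
  - intros [|[|n]] _; simpl; ring.
Qed.

(** The hypothesis bears on the partial sums of [a], which appear at the first division by [q]: in
    the base cases these are bounded away from 0, while for [b = 0] the terms of [a] are eventually
    0. *)
Lemma eventually_ge_div_qpar (s : R) (k : nat) (F : R -> R) (a : nat -> R) :
  asymp_expansion (fun t => qpar t ^ S k * F t) a -> eventually_ge s (sum_f_R0 a) ->
  exists b, asymp_expansion F b /\ eventually_ge s b.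
Proof.
  revert a; induction k as [|k IH]; intros a Ha Hs;
    apply asymp_expansion_div_qpar in Ha; apply eventually_ge_shift in Hs.
  - eexists. split; [|exact Hs]. intros N.
    eapply approx_ext; [| |exact (Ha N)]; [intros; simpl; ring|reflexivity].
  - apply (IH _ Ha).
    apply (eventually_ge_ext _ (fun n => 0 + sum_f_R0 (shift 1 (sum_f_R0 a)) n));
      [intros; ring|].
    now apply eventually_ge_sum.
Qed.

(** [fb_shift] makes [a] the expansion of [2 - f_b], with partial sums 2 minus those of [coef b];
    uniqueness identifies the quotient's expansion with [coef (b + 2)]. *)
Lemma coef_step (s : R) (b : nat) :
  eventually_ge s (fun n => 2 - sum_f_R0 (coef b) n) -> eventually_ge s (coef (b + 2)).
Proof.
  intros H.
  set (a := fun n => 1 * (match n with O => 2 | S _ => 0 end) + -1 * coef b n).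
  destruct (eventually_ge_div_qpar s b (fb (b + 2)) a) as (d & Hd & Hs).
  - intros N. eapply approx_ext;
      [| |exact (approx_lin N _ _ _ _ 1 (-1) (approx_const N 2) (fb_expansion b N))].
    + intros t Ht. replace (S b) with (b + 1)%nat by lia.
      rewrite fb_shift by exact Ht. ring.
    + reflexivity.
  - eapply eventually_ge_ext; [|exact H]. intros n.
    induction n as [|n IH]; [unfold a; simpl; ring|].
    rewrite !tech5, <- IH. unfold a. ring.
  - eapply eventually_ge_ext; [|exact Hs].
    apply (asymp_expansion_unique (fb (b + 2))); [exact Hd|apply fb_expansion].
Qed.

Lemma coef_step2 (s : R) (b : nat) :
  eventually_ge s (coef b) -> eventually_ge (- s) (coef (b + 2)).
Proof.
  intros H. apply coef_step.
  destruct (eventually_ge_sum s (-2) _ H) as (c & N0 & Hc & H').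
  exists c, N0. split; [exact Hc|]. intros n Hn. specialize (H' n Hn). lra.
Qed.

Lemma coef_even (m : nat) : eventually_ge ((-1) ^ m) (coef (2 * m + 2)).
Proof.
  induction m as [|m IH].
  (* All partial sums of [coef 0] equal 1, so [2 - 1 = 1] is the bound. *)
  - apply (coef_step _ 0). exists 1, O. split; [lra|]. intros n _.
    replace (sum_f_R0 (coef 0) n) with 1; [simpl; lra|].
    induction n as [|n IH]; [now rewrite <- (coef_0 0)|].
    rewrite tech5, <- IH, coef_0_S. ring.
  - replace ((-1) ^ S m) with (- (-1) ^ m) by (simpl; ring).
    replace (2 * S m + 2)%nat with (2 * m + 2 + 2)%nat by lia. now apply coef_step2.
Qed.

Lemma coef_odd (m : nat) : eventually_ge (- (-1) ^ m) (coef (2 * m + 3)).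
Proof.
  induction m as [|m IH].
  (* The first two coefficients for [b = 1] already sum to 2, so from index 2 on the partial sums
     exceed 2 by at least [coef 1 2]. *)
  - apply (coef_step _ 1). exists (coef 1 2), 2%nat. split; [apply coef_1_pos|].
    intros n Hn.
    assert (H : 2 + coef 1 2 <= sum_f_R0 (coef 1) n); [|simpl; lra].
    induction Hn as [|n _ IH].
    + change (sum_f_R0 (coef 1) 2) with (coef 1 0 + coef 1 1 + coef 1 2).
      rewrite coef_0, coef_1_1. lra.
    + rewrite tech5. pose proof (coef_1_pos (S n)). lra.
  - replace (- (-1) ^ S m) with (- - (-1) ^ m) by (simpl; ring).
    replace (2 * S m + 3)%nat with (2 * m + 3 + 2)%nat by lia. now apply coef_step2.
Qed.

(** * Signs according to b modulo 4 *)

Lemma pow_neg1_even (d : nat) : (-1) ^ (2 * d) = 1.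
Proof. rewrite pow_mult. replace ((-1) ^ 2) with 1 by ring. apply pow1. Qed.

Theorem theorem1p1 (b : nat) (a : nat -> R) :
  (0 < b)%nat ->
  asymp_expansion (fb b) a ->
  ((b mod 4 = 1 \/ b mod 4 = 2)%nat ->
     exists N0 : nat, forall n : nat, (N0 <= n)%nat -> 0 < a n) /\
  ((b mod 4 = 0 \/ b mod 4 = 3)%nat ->
     exists N0 : nat, forall n : nat, (N0 <= n)%nat -> a n < 0).
Proof.
  intros Hb Ha.
  pose proof (asymp_expansion_unique _ _ _ (fb_expansion b) Ha) as E.
  pose proof (Nat.div_mod_eq b 4) as Hd. set (d := (b / 4)%nat) in Hd.
  assert (Hpos : eventually_ge 1 (coef b) ->
                 exists N0 : nat, forall n : nat, (N0 <= n)%nat -> 0 < a n).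
  { intros (c & N0 & Hc & H). exists N0. intros n Hn. specialize (H n Hn).
    rewrite <- E. lra. }
  assert (Hneg : eventually_ge (-1) (coef b) ->
                 exists N0 : nat, forall n : nat, (N0 <= n)%nat -> a n < 0).
  { intros (c & N0 & Hc & H). exists N0. intros n Hn. specialize (H n Hn).
    rewrite <- E. lra. }
  pose proof (pow_neg1_even d) as P.
  split; intros [Hm|Hm]; rewrite Hm in Hd.
  (* [b = 1] is treated directly, since [coef_odd] starts at 3; otherwise [b = 2 (2 d' + 1) + 3]. *)
  - destruct d as [|d'].
    + exists O. intros n _. rewrite <- E. replace b with 1%nat by lia. apply coef_1_pos.
    + apply Hpos. pose proof (coef_odd (2 * d' + 1)) as H.
      rewrite pow_add, pow_neg1_even in H.
      replace (2 * (2 * d' + 1) + 3)%nat with b in H by lia.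
      replace (- (1 * (-1) ^ 1)) with 1 in H by ring. exact H.
  - apply Hpos. pose proof (coef_even (2 * d)) as H. rewrite P in H.
    now replace (2 * (2 * d) + 2)%nat with b in H by lia.
  (* [d = 0] would mean [b = 0]; otherwise [b = 2 (2 d' + 1) + 2]. *)
  - apply Hneg. destruct d as [|d']; [lia|].
    pose proof (coef_even (2 * d' + 1)) as H.
    rewrite pow_add, pow_neg1_even in H.
    replace (2 * (2 * d' + 1) + 2)%nat with b in H by lia.
    replace (1 * (-1) ^ 1) with (-1) in H by ring. exact H.
  - apply Hneg. pose proof (coef_odd (2 * d)) as H. rewrite P in H.
    replace (2 * (2 * d) + 3)%nat with b in H by lia.
    replace (- (1)) with (-1) in H by ring. exact H.
Qed.
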